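(* Let $d,\alpha>1$ and let $1\le k\le n$ be integers, and fix a constant $\beta\ge 1$. There is a random linear map $G:\mathbb{R}^d\to\mathbb{R}^t$ with target dimension $t=O(\log k+\tfrac{d}{\alpha^2})$ (the hidden constant may depend on $\beta$) such that for every set $P\subset\mathbb{R}^d$ of size $n$, with probability at least $2/3$: (1) $\mathrm{OPT}_{vanilla}(G(P))$ is an $O(\alpha)$-estimation of $\mathrm{OPT}_{vanilla}(P)$; and (2) every set $C\subset P$ of size $k$ is an $O(\alpha)$-approximate vanilla $k$-center solution of $P$ whenever $G(C)$ is a $\beta$-approximate vanilla $k$-center solution of $G(P)$.
   Context: All norms are Euclidean. For $x\in\mathbb{R}^m$ and finite $C\subset\mathbb{R}^m$, $\mathrm{dist}(x,C)=\min_{c\in C}\|x-c\|$. For a finite set $X\subset\mathbb{R}^m$, the vanilla $k$-center value is $\mathrm{OPT}_{vanilla}(X)=\min_{C\subset\mathbb{R}^m,|C|=k}\max_{x\in X}\mathrm{dist}(x,C)$. For $X\subset\mathbb{R}^d$, $G(X)=\{Gx:x\in X\}$. A set $C\subset X$ of size $k$ is a $\gamma$-approximate vanilla $k$-center solution of $X$ if $\max_{x\in X}\mathrm{dist}(x,C)\le\gamma\,\mathrm{OPT}_{vanilla}(X)$. A number $y$ is a $\gamma$-estimation of a number $x\ge 0$ if $x\le y\le\gamma x$. The $O(\cdot)$ notation hides universal constants (depending only on $\beta$).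
   Formalization: The target dimension is taken as t = O(1 + log k + d/α²): without the added 1 the claim fails for k = 1, n = 2 and α² much larger than d, where the bound would force t = 0. *)

(* Defs.v *)
From HB Require Import structures.
From mathcomp Require Import all_boot all_order all_algebra.
From mathcomp Require Import all_classical all_reals all_analysis.
Set Implicit Arguments. Unset Strict Implicit. Unset Printing Implicit Defensive.
Import Order.TTheory GRing.Theory Num.Theory.
Local Open Scope ring_scope.

Section KCenter.
Variable R : realType.

Definition enorm (m : nat) (v : 'rV[R]_m) : R :=
  Num.sqrt (\sum_(i < m) v ord0 i ^+ 2).

(* dist(x, C) = min_{c in C} ||x - c||  (C nonempty; 0 for C empty, never used) *)
Definition dist_to (m : nat) (x : 'rV[R]_m) (C : seq 'rV[R]_m) : R :=
  match C with
  | [::] => 0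
  | c :: C' => foldr (fun c' r => Num.min (enorm (x - c')) r) (enorm (x - c)) C'
  end.

(* max_{x in X} dist(x, C)  (distances are >= 0, so 0 is a neutral start) *)
Definition kcost (m : nat) (X C : seq 'rV[R]_m) : R :=
  foldr (fun x r => Num.max (dist_to x C) r) 0 X.

Definition opt_vanilla (k m : nat) (X : seq 'rV[R]_m) : R :=
  inf [set r : R | exists C : seq 'rV[R]_m,
         [/\ uniq C, size C = k & r = kcost X C]].

Definition approx_sol (k m : nat) (gamma : R) (X C : seq 'rV[R]_m) : Prop :=
  [/\ uniq C, size C = k, {subset C <= X} &
      kcost X C <= gamma * opt_vanilla k X].

Definition estimation (gamma x y : R) : Prop := x <= y /\ y <= gamma * x.

Definition image_of (d t : nat) (G : 'M[R]_(d, t)) (X : seq 'rV[R]_d) :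
  seq 'rV[R]_t := map (fun x => x *m G) X.

End KCenter.

(* Main.v *)
Require Import Defs.
From HB Require Import structures.
From mathcomp Require Import all_boot all_order all_algebra.
From mathcomp Require Import all_classical all_reals all_analysis.
From mathcomp Require Import ring lra.
Import Order.TTheory GRing.Theory Num.Theory.
Local Open Scope ring_scope.
Set Implicit Arguments. Unset Strict Implicit. Unset Printing Implicit Defensive.

(* The random map is a rescaled matrix of independent signs. With good probability its
   operator norm is O(alpha) (a union bound over lattice nets of both unit balls, the
   bilinear form being subgaussian), and it does not contract any of the O(k^2)
   differences of k + 1 points of P: the k points S found by farthest-point traversal
   and the point of P farthest from S. These k + 1 points are separated by the covering
   radius rho of S, and rho is within a factor 2 of the optimum. All other points of P
   are handled through S: moving them to S costs rho in the source and, by the operator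
   norm bound, O(alpha rho) in the image. *)

(** * Euclidean norm: Cauchy-Schwarz and the triangle inequality *)

Section EuclideanNorm.
Variable R : realType.
Implicit Types (m : nat) (c : R).

Definition sqnorm m (v : 'rV[R]_m) : R := \sum_(i < m) v ord0 i ^+ 2.

Lemma sqnorm_ge0 m (v : 'rV[R]_m) : 0 <= sqnorm v.
Proof. by apply: sumr_ge0 => i _; apply: sqr_ge0. Qed.

Lemma sqnormZ m c (v : 'rV[R]_m) : sqnorm (c *: v) = c ^+ 2 * sqnorm v.
Proof.
by rewrite /sqnorm mulr_sumr; apply: eq_bigr => i _; rewrite mxE exprMn.
Qed.

Lemma sqnorm_eq0 m (v : 'rV[R]_m) : sqnorm v = 0 -> v = 0.
Proof.
move=> /eqP; rewrite psumr_eq0; last by move=> i _; apply: sqr_ge0.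
move=> /allP h; apply/rowP => i; rewrite mxE.
by have := h i (mem_index_enum i); rewrite /= sqrf_eq0 => /eqP.
Qed.

Lemma sqnorm_mulmx m (v : 'rV[R]_m) : (v *m v^T) ord0 ord0 = sqnorm v.
Proof. by rewrite mxE; apply: eq_bigr => i _; rewrite mxE expr2. Qed.

Lemma enorm_ge0 m (v : 'rV[R]_m) : 0 <= enorm v.
Proof. exact: sqrtr_ge0. Qed.

Lemma sqr_enorm m (v : 'rV[R]_m) : enorm v ^+ 2 = sqnorm v.
Proof. by rewrite sqr_sqrtr // sqnorm_ge0. Qed.

Lemma enorm_eq0 m (v : 'rV[R]_m) : enorm v = 0 -> v = 0.
Proof. by move=> h; apply: sqnorm_eq0; rewrite -sqr_enorm h expr0n. Qed.

Lemma enorm0 m : enorm (0 : 'rV[R]_m) = 0.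
Proof.
apply/eqP; rewrite -sqrf_eq0 sqr_enorm /sqnorm big1 // => i _.
by rewrite mxE expr0n.
Qed.

Lemma enormZ m c (v : 'rV[R]_m) : enorm (c *: v) = `|c| * enorm v.
Proof.
apply/eqP; rewrite -(@eqrXn2 _ 2) ?mulr_ge0 ?enorm_ge0 //.
by rewrite exprMn !sqr_enorm sqnormZ real_normK // num_real.
Qed.

Lemma enormN m (v : 'rV[R]_m) : enorm (- v) = enorm v.
Proof. by rewrite -scaleN1r enormZ normrN normr1 mul1r. Qed.

Lemma enormBC m (u v : 'rV[R]_m) : enorm (u - v) = enorm (v - u).
Proof. by rewrite -enormN opprB. Qed.

(** Expanding the squared norm of [sqnorm v *: u - C *: v] gives [sqnorm v] times the Cauchy-Schwarz
    defect, which is therefore nonnegative. *)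
Lemma inner_le_enorm m (u v : 'rV[R]_m) :
  \sum_(i < m) u ord0 i * v ord0 i <= enorm u * enorm v.
Proof.
set C := \sum_(i < m) _.
have [/enorm_eq0 v0|v0] := eqVneq (enorm v) 0.
  rewrite /C big1 ?mulr_ge0 ?enorm_ge0 // => i _.
  by rewrite v0 mxE mulr0.
have vp : 0 < sqnorm v.
  by rewrite -sqr_enorm exprn_gt0 // lt0r v0 enorm_ge0.
have h : 0 <= sqnorm v * (sqnorm u * sqnorm v - C ^+ 2).
  have -> : sqnorm v * (sqnorm u * sqnorm v - C ^+ 2) =
      \sum_(i < m) (sqnorm v * u ord0 i - C * v ord0 i) ^+ 2.
    transitivity (\sum_(i < m) (sqnorm v ^+ 2 * u ord0 i ^+ 2
       + ((- 2 * sqnorm v * C) * (u ord0 i * v ord0 i)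
          + C ^+ 2 * v ord0 i ^+ 2))); last first.
      by apply: eq_bigr => i _; ring.
    rewrite !big_split /= -!mulr_sumr -/C -/(sqnorm v) -/(sqnorm u); ring.
  by apply: sumr_ge0 => i _; apply: sqr_ge0.
move: h; rewrite pmulr_rge0 // subr_ge0 => h.
rewrite (le_trans (ler_norm _)) // -(@ler_pXn2r _ 2) ?nnegrE
  ?mulr_ge0 ?enorm_ge0 //.
by rewrite exprMn !sqr_enorm real_normK // num_real.
Qed.

Lemma enormD m (u v : 'rV[R]_m) : enorm (u + v) <= enorm u + enorm v.
Proof.
rewrite -(@ler_pXn2r _ 2) ?nnegrE ?addr_ge0 ?enorm_ge0 //.
rewrite sqr_enorm.
have -> : sqnorm (u + v) =
    sqnorm u + 2 * (\sum_(i < m) u ord0 i * v ord0 i) + sqnorm v.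
  rewrite /sqnorm mulr_sumr -!big_split /=.
  by apply: eq_bigr => i _; rewrite mxE; ring.
rewrite sqrrD !sqr_enorm lerD2r lerD2l mulr_natl ler_pMn2r //.
exact: inner_le_enorm.
Qed.

Lemma enorm_triangle m (v u w : 'rV[R]_m) :
  enorm (u - w) <= enorm (u - v) + enorm (v - w).
Proof. by rewrite -{1}[u](subrK v) -addrA enormD. Qed.

Lemma sqnorm_coord m (v : 'rV[R]_m) i : v ord0 i ^+ 2 <= sqnorm v.
Proof.
rewrite /sqnorm (bigD1 i) //= lerDl.
by apply: sumr_ge0 => j _; apply: sqr_ge0.
Qed.

End EuclideanNorm.

(** * The k-center cost, its lower bound by separated points, and farthest-point traversal *)

Section KCenterCost.
Variables (R : realType) (m : nat).
Implicit Types (x y c : 'rV[R]_m) (X C S P : seq 'rV[R]_m).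

Lemma dist_to_le x c C : c \in C -> dist_to x C <= enorm (x - c).
Proof.
case: C => [//|c0 C] /=; elim: C => [|c1 C IH] /=.
  by rewrite inE => /eqP ->.
rewrite !inE => h; rewrite ge_min.
have [-> //=|/= n1] := eqVneq c c1; first by rewrite lexx.
by rewrite IH ?orbT // inE; move: h; rewrite (negbTE n1).
Qed.

Lemma dist_to_mem x C : C != [::] -> exists2 c, c \in C & dist_to x C = enorm (x - c).
Proof.
case: C => [//|c0 C] _ /=; elim: C => [|c1 C [c cC e]] /=.
  by exists c0; rewrite ?inE.
rewrite e; case: leP => _.
  by exists c1; rewrite // !inE eqxx orbT.
by exists c => //; move: cC; rewrite !inE => /orP[->//|->]; rewrite !orbT.
Qed.

Lemma kcost_ge0 X C : 0 <= kcost X C.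
Proof. by elim: X => [//|x X IH] /=; rewrite le_max IH orbT. Qed.

Lemma dist_to_le_kcost x X C : x \in X -> dist_to x C <= kcost X C.
Proof.
elim: X => [//|y X IH] /=; rewrite inE le_max => /orP[/eqP ->|/IH ->].
  by rewrite lexx.
by rewrite orbT.
Qed.

Lemma kcost_le X C r : 0 <= r -> (forall x, x \in X -> dist_to x C <= r) ->
  kcost X C <= r.
Proof.
move=> r0; elim: X => [//|x X IH] h /=; rewrite ge_max h ?inE ?eqxx //=.
by apply: IH => y yX; apply: h; rewrite inE yX orbT.
Qed.

Lemma kcost_attained X C : X != [::] -> C != [::] ->
  exists2 x, x \in X & kcost X C = dist_to x C.
Proof.
case: X => [//|x0 X] _ C0; elim: X x0 => [|x1 X IH] x0.
  exists x0; rewrite ?inE //=; apply/max_idPl.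
  by have [c _ ->] := dist_to_mem x0 C0; apply: enorm_ge0.
have [x xX e] := IH x1.
rewrite (_ : kcost [:: x0, x1 & X] C =
  Num.max (dist_to x0 C) (kcost (x1 :: X) C)) // e.
case: leP => _; last by exists x0; rewrite // inE eqxx.
by exists x; rewrite // inE xX orbT.
Qed.

Lemma opt_vanilla_le k X C : uniq C -> size C = k -> opt_vanilla k X <= kcost X C.
Proof.
move=> uC sC; apply: ge_inf; last by exists C.
by exists 0 => _ [D [_ _ ->]]; apply: kcost_ge0.
Qed.

(** The witness keeps the set of costs nonempty: in dimension 0 there is only one point, and the
    infimum of the empty set is 0 by convention. *)
Lemma le_opt_vanilla k X r : (exists2 C : seq 'rV[R]_m, uniq C & size C = k) ->
  (forall C, uniq C -> size C = k -> r <= kcost X C) -> r <= opt_vanilla k X.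
Proof.
move=> [C0 u0 s0] h; apply: lb_le_inf; first by exists (kcost X C0); exists C0.
by move=> _ [C [uC sC ->]]; apply: h.
Qed.

(* Pigeonhole: two of the k + 1 separated points share their nearest center. *)
Lemma separated_le_kcost k X T C r : size C = k -> (0 < k)%N -> size T = k.+1 ->
  {subset T <= X} -> pairwise (fun u v : 'rV[R]_m => r <= enorm (u - v)) T ->
  r <= 2 * kcost X C.
Proof.
move=> sC k0 sT TX pT.
have C0 : C != [::] by case: C sC k0 => //= <-.
have /boolp.choice [near nearP] : forall x, exists c,
    c \in C /\ dist_to x C = enorm (x - c).
  by move=> x; have [c ? ?] := dist_to_mem x C0; exists c.
have /(@uniqPn _ 0) [i [j [ij]]] : ~~ uniq (map near T).
  apply/negP => uT; have : (size (map near T) <= size C)%N.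
    by apply: uniq_leq_size => // _ /mapP [x _ ->]; case: (nearP x).
  by rewrite size_map sT sC ltnn.
rewrite size_map => jT; rewrite !(nth_map 0) //; last exact: ltn_trans jT.
set u := nth 0 T i; set v := nth 0 T j => e.
have iT : (i < size T)%N by apply: ltn_trans jT.
apply: (@le_trans _ _ (enorm (u - v))).
  by move: pT => /(pairwiseP 0) /(_ i j); rewrite !inE; apply.
have near_le x : x \in T -> enorm (x - near x) <= kcost X C.
  by move=> xT; case: (nearP x) => _ <-; apply/dist_to_le_kcost/TX.
apply: le_trans (enorm_triangle (near u) u v) _.
rewrite mulr_natl mulr2n lerD ?near_le ?mem_nth //.
by rewrite enormBC e near_le // mem_nth.
Qed.

(** Greedy induction: the point of [P] farthest from [S] is at distance at least [kcost P S] from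
    all of [S], and adding it can only lower the cost, so earlier separations stay sufficient. *)
Lemma farthest_point_traversal k P : (0 < k)%N -> (k <= size P)%N -> uniq P ->
  exists S, [/\ uniq S, size S = k, {subset S <= P} &
    pairwise (fun u v : 'rV[R]_m => kcost P S <= enorm (u - v)) S].
Proof.
case: k => [//|k] _; elim: k => [|k IH] kP uP.
  have [p pP] : exists p, p \in P.
    by case: P kP {uP} => [//|p P]; exists p; rewrite inE eqxx.
  by exists [:: p]; split => // x; rewrite inE => /eqP ->.
have [S [uS sS SP pS]] := IH (ltnW kP) uP.
have S0 : S != [::] by rewrite -size_eq0 sS.
have P0 : P != [::] by rewrite -size_eq0 -lt0n (leq_trans _ kP).
have [x xP ex] := kcost_attained P0 S0.
have x_far s : s \in S -> kcost P S <= enorm (x - s).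
  by rewrite ex; apply: dist_to_le.
(* Positivity makes the farthest point new; it holds because [P] still has a point outside [S]. *)
have cost_gt0 : 0 < kcost P S.
  have [y yP yS] : exists2 y, y \in P & y \notin S.
    apply: contrapT => h.
    have : (size P <= size S)%N.
      apply: uniq_leq_size => // y yP; apply/negPn/negP => yS.
      by apply: h; exists y.
    by rewrite sS leqNgt kP.
  apply: lt_le_trans (dist_to_le_kcost S yP).
  have [c cS ->] := dist_to_mem y S0.
  rewrite lt0r enorm_ge0 andbT; apply/eqP => /enorm_eq0 /eqP.
  by rewrite subr_eq0 => /eqP e; rewrite e cS in yS.
have xS : x \notin S.
  apply/negP => /x_far; rewrite subrr enorm0; lra.
exists (x :: S); split => /=; rewrite ?xS ?sS //.
  by move=> y; rewrite inE => /orP[/eqP ->|/SP].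
have cost_mono : kcost P (x :: S) <= kcost P S.
  apply: kcost_le => [|y yP]; first exact: kcost_ge0.
  apply: le_trans (dist_to_le_kcost S yP).
  have [c cS ->] := dist_to_mem y S0.
  by apply: dist_to_le; rewrite inE cS orbT.
apply/andP; split.
  by apply/allP => s /x_far; apply: le_trans.
by apply: sub_pairwise pS => u v; apply: le_trans.
Qed.

(** One more farthest point, without making it a center, gives the [k + 1] separated points that the
    pigeonhole bound requires. *)
Lemma separated_core k P : (0 < k)%N -> (k <= size P)%N -> uniq P ->
  exists S x, [/\ uniq S, size S = k, {subset x :: S <= P} &
    pairwise (fun u v : 'rV[R]_m => kcost P S <= enorm (u - v)) (x :: S)].
Proof.
move=> k0 kP uP; have [S [uS sS SP pS]] := farthest_point_traversal k0 kP uP.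
have S0 : S != [::] by rewrite -size_eq0 sS -lt0n.
have P0 : P != [::] by rewrite -size_eq0 -lt0n (leq_trans _ kP).
have [x xP ex] := kcost_attained P0 S0.
exists S, x; split => //.
  by move=> y; rewrite inE => /orP[/eqP ->|/SP].
by rewrite /= pS andbT; apply/allP => s; rewrite ex; apply: dist_to_le.
Qed.

End KCenterCost.

(** * Deterministic guarantees for a map that is bounded everywhere and expands the core *)

Section Embedding.
Variables (R : realType) (d t k : nat) (G : 'M[R]_(d, t)) (U : R).
Variables (P S : seq 'rV[R]_d) (x0 : 'rV[R]_d).
Hypotheses (k_gt0 : (0 < k)%N) (uS : uniq S) (sS : size S = k).
Hypothesis coreP : {subset x0 :: S <= P}.
Hypothesis core_sep :
  pairwise (fun u v : 'rV[R]_d => kcost P S <= enorm (u - v)) (x0 :: S).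
Hypothesis U_ge0 : 0 <= U.
Hypothesis G_upper : forall v : 'rV[R]_d, enorm (v *m G) <= U * enorm v.
Hypothesis G_lower : forall u v, u \in x0 :: S -> v \in x0 :: S ->
  2 * enorm (u - v) <= enorm ((u - v) *m G).

Let rho := kcost P S.

Let S_neq0 : S != [::]. Proof. by rewrite -size_eq0 sS -lt0n. Qed.

Lemma opt_le_core_radius : opt_vanilla k P <= rho.
Proof. exact: opt_vanilla_le. Qed.

Lemma core_radius_le_opt : rho <= 2 * opt_vanilla k P.
Proof.
rewrite mulrC -ler_pdivrMr //; apply: le_opt_vanilla; first by exists S.
move=> C _ sC; rewrite ler_pdivrMr // mulrC.
by apply: (separated_le_kcost sC k_gt0 _ coreP core_sep) => /=; rewrite sS.
Qed.

(** Center sets are duplicate-free, so [G] must be injective on [S] for the image of [S] to compete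
    in the optimum of the image. *)
Lemma image_core_uniq : uniq (image_of G S).
Proof.
rewrite map_inj_in_uniq // => u v uI vI e.
have := G_lower (mem_behead (s := x0 :: S) uI) (mem_behead (s := x0 :: S) vI).
rewrite mulmxBl e subrr enorm0 => h.
apply/eqP; rewrite -subr_eq0; apply/eqP/enorm_eq0/le_anti.
by rewrite enorm_ge0 andbT; lra.
Qed.

Lemma image_opt_le : opt_vanilla k (image_of G P) <= U * rho.
Proof.
apply: le_trans (opt_vanilla_le _ image_core_uniq _) _; first by rewrite size_map.
apply: kcost_le => [|_ /mapP [x xP ->]]; first by rewrite mulr_ge0 // kcost_ge0.
have [s sI e] := dist_to_mem x S_neq0.
apply: le_trans (dist_to_le _ (map_f _ sI)) _.
rewrite -mulmxBl; apply: le_trans (G_upper _) _; rewrite ler_wpM2l //.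
by rewrite -e dist_to_le_kcost.
Qed.

(** The factor 2 in [G_lower] pays for the factor 2 lost in the pigeonhole bound: core images are
    [2 * rho] apart, so every center set in the image costs at least [rho]. *)
Lemma opt_le_image_opt : opt_vanilla k P <= opt_vanilla k (image_of G P).
Proof.
apply: le_trans opt_le_core_radius _; apply: le_opt_vanilla.
  by exists (image_of G S); rewrite ?image_core_uniq // size_map.
move=> C _ sC; rewrite -(@ler_pM2l _ 2) //.
have sT : size (image_of G (x0 :: S)) = k.+1 by rewrite size_map /= sS.
apply: (separated_le_kcost sC k_gt0 sT).
  by move=> _ /mapP [x xT ->]; apply/map_f/coreP.
rewrite /image_of pairwise_map.
apply/(pairwiseP 0) => i j iT jT ij; rewrite /= -mulmxBl.
apply: le_trans (G_lower _ _); rewrite ?mem_nth //.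
by rewrite ler_pM2l //; move: core_sep => /(pairwiseP 0); apply.
Qed.

Lemma embedding_estimation :
  estimation (2 * U) (opt_vanilla k P) (opt_vanilla k (image_of G P)).
Proof.
split; first exact: opt_le_image_opt.
apply: le_trans image_opt_le _; rewrite [2 * U]mulrC -mulrA ler_wpM2l //.
exact: core_radius_le_opt.
Qed.

(* Only distances between core points are bounded below by [G]: a point and its
   center are first moved to the core, at a cost of [U * rho] each in the image. *)
Lemma embedding_approx beta C : 0 <= beta -> uniq C -> size C = k ->
  {subset C <= P} -> approx_sol k beta (image_of G P) (image_of G C) ->
  approx_sol k (4 + (beta + 2) * U) P C.
Proof.
move=> beta0 uC sC CP [_ _ _ costC]; split => //.
have opt0 : 0 <= opt_vanilla k P.
  by have := core_radius_le_opt; have := kcost_ge0 P S; rewrite -/rho; lra.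
apply: kcost_le => [|x xP].
  by rewrite mulr_ge0 // addr_ge0 // mulr_ge0 // addr_ge0.
have C0 : image_of G C != [::] by rewrite -size_eq0 size_map sC -lt0n.
have [_ /mapP [c cC ->] exc] := dist_to_mem (x *m G) C0.
apply: le_trans (dist_to_le _ cC) _.
have xc : enorm ((x - c) *m G) <= beta * (U * rho).
  have xPG : x *m G \in image_of G P by apply: map_f.
  rewrite mulmxBl -exc; apply: le_trans (dist_to_le_kcost _ xPG) _.
  by apply: le_trans costC _; rewrite ler_wpM2l // image_opt_le.
have [s sI es] := dist_to_mem x S_neq0; have [s' s'I es'] := dist_to_mem c S_neq0.
have xs : enorm (x - s) <= rho by rewrite -es dist_to_le_kcost.
have cs : enorm (c - s') <= rho by rewrite -es' dist_to_le_kcost // CP.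
have xsG : enorm ((s - x) *m G) <= U * rho.
  by apply: le_trans (G_upper _) _; rewrite ler_wpM2l // enormBC.
have csG : enorm ((c - s') *m G) <= U * rho.
  by apply: le_trans (G_upper _) _; rewrite ler_wpM2l.
have ss : 2 * enorm (s - s') <= (beta + 2) * U * rho.
  apply: le_trans (G_lower (mem_behead (s := x0 :: S) sI)
    (mem_behead (s := x0 :: S) s'I)) _.
  have -> : s - s' = (s - x) + ((x - c) + (c - s')) by rewrite !addrA !subrK.
  rewrite mulmxDl; apply: le_trans (enormD _ _) _.
  have := enormD ((x - c) *m G) ((c - s') *m G); rewrite -mulmxDl; nra.
(* Along [x], [s], [s'], [c] the distance is at most [2 * rho] plus half of [(beta + 2) * U * rho];
   then [rho] is at most twice the optimum. *)
have := enorm_triangle s x c; have := enorm_triangle s' s c.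
rewrite (enormBC s' c) => h1 h2.
have h3 : (beta + 2) * U * rho <= (beta + 2) * U * (2 * opt_vanilla k P).
  rewrite ler_wpM2l ?core_radius_le_opt // mulr_ge0 // addr_ge0 //.
have := core_radius_le_opt; nra.
Qed.

End Embedding.


(** * Lattice nets of the unit ball: approximation and cardinality *)

Section Net.
Variable R : realType.

(** A cube of this side in dimension [d] has diagonal 1/4, which is the rounding error of the
    net. *)
Definition mesh (d : nat) : R := (4 * Num.sqrt d%:R)^-1.

(* Points of the unit ball of the scaled integer lattice [mesh d * Z^d], encoded by
   a sign and an absolute value in each coordinate. *)
Definition net_point d (z : {ffun 'I_d -> bool * 'I_(4 * d).+1}) : 'rV[R]_d :=
  \row_i ((-1) ^+ (z i).1 * (z i).2%:R * mesh d).

(** Since [16 * d] is the inverse square of the mesh, the condition says that the squared norm is at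
    most 1. It forces each absolute value to be at most [4 * d], so the range of the encoding cuts
    off no lattice point of the ball. *)
Definition net d : {set {ffun 'I_d -> bool * 'I_(4 * d).+1}} :=
  [set z : {ffun 'I_d -> bool * 'I_(4 * d).+1} |
    (\sum_i (z i).2 ^ 2 <= 16 * d)%N]%SET.

Lemma mesh_gt0 d : (0 < d)%N -> 0 < mesh d.
Proof. by move=> d0; rewrite invr_gt0 mulr_gt0 // sqrtr_gt0 ltr0n. Qed.

Lemma sqr_mesh d : (0 < d)%N -> mesh d ^+ 2 * (16 * d)%:R = 1.
Proof.
move=> d0; rewrite exprVn exprMn sqr_sqrtr // natrM.
rewrite -natrX mulVf // mulf_neq0 // ?pnatr_eq0 //; by rewrite -lt0n.
Qed.

Lemma sqnorm_net_point d (z : {ffun 'I_d -> bool * 'I_(4 * d).+1}) :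
  sqnorm (net_point z) = (\sum_i (z i).2 ^ 2)%:R * mesh d ^+ 2.
Proof.
rewrite natr_sum mulr_suml; apply: eq_bigr => i _.
by rewrite mxE !exprMn sqrr_sign mul1r natrX.
Qed.

Lemma net_point_in_ball d z : (0 < d)%N -> z \in net d -> sqnorm (net_point z) <= 1.
Proof.
move=> d0; rewrite inE => h; rewrite sqnorm_net_point -[leRHS](sqr_mesh d0) mulrC.
by rewrite ler_wpM2l ?sqr_ge0 // ler_nat.
Qed.

(* Rounding every coordinate towards 0 stays in the ball. *)
Lemma net_approx d (x : 'rV[R]_d) : (0 < d)%N -> sqnorm x <= 1 ->
  exists2 z, z \in net d & sqnorm (x - net_point z) <= 1 / 16.
Proof.
move=> d0 x1; have m0 := mesh_gt0 d0.
pose a i := Num.truncn (`|x ord0 i| / mesh d).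
have a_le i : (a i)%:R * mesh d <= `|x ord0 i|.
  by rewrite -ler_pdivlMr // truncn_le divr_ge0 // ltW.
have a_gt i : `|x ord0 i| < ((a i)%:R + 1) * mesh d.
  by rewrite -ltr_pdivrMr // natr1 truncnS_gt.
have sum_a : (\sum_i a i ^ 2 <= 16 * d)%N.
  rewrite -(@ler_nat R) -(@ler_pM2l _ (mesh d ^+ 2)) ?exprn_gt0 // sqr_mesh //.
  rewrite natr_sum mulr_sumr; apply: le_trans x1; apply: ler_sum => i _.
  rewrite natrX -exprMn mulrC -(real_normK (num_real (x ord0 i))).
  by rewrite lerXn2r // nnegrE // mulr_ge0 // ltW.
have a_small i : (a i < (4 * d).+1)%N.
  have h : (a i ^ 2 <= 16 * d)%N.
    by apply: leq_trans sum_a; rewrite (bigD1 i) //= leq_addr.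
  rewrite ltnS -leq_sqr; apply: leq_trans h _.
  by rewrite expnMn leq_mul2l /= -{1}[d]expn1 leq_pexp2l.
pose z := [ffun i => (x ord0 i < 0, Ordinal (a_small i))].
exists z.
  by rewrite inE; under eq_bigr do rewrite ffunE.
have -> : 1 / 16 = \sum_(i < d) mesh d ^+ 2.
  by rewrite sumr_const card_ord -mulr_natr; have := sqr_mesh d0; rewrite natrM; lra.
apply: ler_sum => i _; rewrite !mxE ffunE /=.
have -> : (x ord0 i - (-1) ^+ (x ord0 i < 0)%R * (a i)%:R * mesh d) ^+ 2 =
    (`|x ord0 i| - (a i)%:R * mesh d) ^+ 2.
  have [h|h] := ltP (x ord0 i) 0.
    by rewrite ltr0_norm //= expr1; ring.
  by rewrite ger0_norm //= expr0 mul1r.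
rewrite lerXn2r ?nnegrE ?subr_ge0 ?a_le //; first exact: ltW.
by have := a_gt i; lra.
Qed.

Lemma geometric_half_sum n : \sum_(j < n) (1 / 2 : R) ^+ j <= 2.
Proof.
suff -> : \sum_(j < n) (1 / 2 : R) ^+ j = 2 - 2 * (1 / 2) ^+ n.
  by rewrite lerBlDr lerDl mulr_ge0 // exprn_ge0.
elim: n => [|n IH]; first by rewrite big_ord0 expr0; lra.
by rewrite big_ord_recr /= IH exprS; lra.
Qed.

(* Since [a <= a ^ 2] on the integers, a net point has total weight at least
   [2 ^ - (16 d)] for the product weight [2 ^ - |z_i|]. *)
Lemma card_net d : #|net d|%:R <= (2 : R) ^+ (18 * d).
Proof.
have -> : (2 : R) ^+ (18 * d) = 2 ^+ (16 * d) * (2 ^+ 2) ^+ d.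
  by rewrite -exprM -exprD -mulnDl.
pose F (i : 'I_d) (p : bool * 'I_(4 * d).+1) : R := (1 / 2) ^+ p.2.
have F0 i p : 0 <= F i p by rewrite exprn_ge0.
have -> : #|net d|%:R = \sum_(z in net d) (1 : R) by rewrite sumr_const.
apply: (@le_trans _ _ (\sum_(z : {ffun 'I_d -> bool * 'I_(4 * d).+1})
    2 ^+ (16 * d) * \prod_i F i (z i))).
  rewrite big_mkcond /=; apply: ler_sum => z _.
  have p0 : 0 <= 2 ^+ (16 * d) * \prod_i F i (z i).
    by rewrite mulr_ge0 ?exprn_ge0 // prodr_ge0.
  case: ifP => //; rewrite inE => h.
  have -> : \prod_i F i (z i) = (1 / 2) ^+ (\sum_i (z i).2)%N.
    rewrite /F; elim/big_rec2: _ => [|i a b _ ->]; first by rewrite expr0.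
    by rewrite exprD.
  apply: (@le_trans _ _ (2 ^+ (16 * d) * (1 / 2) ^+ (16 * d))).
    by rewrite -exprMn mulrC divfK // expr1n.
  rewrite ler_wpM2l ?exprn_ge0 // ler_wiXn2l //; first lra.
  apply: leq_trans h; apply: leq_sum => i _.
  by rewrite -mulnn; case: (nat_of_ord _) => // n; rewrite leq_pmulr.
(* The total weight factors over the coordinates; each contributes two signs times a geometric sum,
   hence at most 4. *)
rewrite -mulr_sumr ler_wpM2l ?exprn_ge0 // -bigA_distr_bigA /=.
have -> : ((2 : R) ^+ 2) ^+ d = \prod_(i < d) 2 ^+ 2.
  by rewrite prodr_const card_ord.
apply: ler_prod => i _; rewrite sumr_ge0 //=.
rewrite -(pair_big xpredT xpredT (fun _ j => (1 / 2) ^+ (nat_of_ord j))) /= big_bool /=.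
have := geometric_half_sum (4 * d).+1; rewrite expr2; lra.
Qed.

End Net.

(** * From the bilinear form on nets to the operator norm *)

Section OperatorNorm.
Variables (R : realType) (d t : nat).
Implicit Types (G : 'M[R]_(d, t)).

Definition bilin G (x : 'rV[R]_d) (y : 'rV[R]_t) : R :=
  (x *m G *m y^T) ord0 ord0.

Lemma bilinE G x y :
  bilin G x y = \sum_j \sum_i x ord0 i * G i j * y ord0 j.
Proof.
rewrite /bilin mxE; apply: eq_bigr => j _.
by rewrite !mxE mulr_suml.
Qed.

Lemma bilinDl G x x' y : bilin G (x + x') y = bilin G x y + bilin G x' y.
Proof. by rewrite /bilin !mulmxDl mxE. Qed.

Lemma bilinDr G x y y' : bilin G x (y + y') = bilin G x y + bilin G x y'.
Proof. by rewrite /bilin linearD /= mulmxDr mxE. Qed.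

Lemma bilinZl G a x y : bilin G (a *: x) y = a * bilin G x y.
Proof. by rewrite /bilin -!scalemxAl mxE. Qed.

Lemma bilinZr G a x y : bilin G x (a *: y) = a * bilin G x y.
Proof. by rewrite /bilin linearZ /= -scalemxAr mxE. Qed.

(** A crude bound, used only to make the supremum over the two unit balls finite. *)
Lemma bilin_entries G x y : sqnorm x <= 1 -> sqnorm y <= 1 ->
  bilin G x y <= \sum_j \sum_i `|G i j|.
Proof.
move=> x1 y1; rewrite bilinE; apply: ler_sum => j _; apply: ler_sum => i _.
have coord1 m (v : 'rV[R]_m) l : sqnorm v <= 1 -> `|v ord0 l| <= 1.
  move=> v1; rewrite -(@ler_pXn2r _ 2) ?nnegrE // expr1n.
  by rewrite real_normK ?num_real // (le_trans (sqnorm_coord _ _)).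
apply: le_trans (ler_norm _) _; rewrite !normrM -[leRHS]mulr1.
by rewrite ler_pM ?mulr_ge0 ?coord1 // -[leRHS]mul1r ler_wpM2r ?coord1.
Qed.

Hypotheses (d_gt0 : (0 < d)%N) (t_gt0 : (0 < t)%N).

(** Rounding [x] and then [y] to the nets leaves two residual terms, each at most a quarter of the
    supremum over the balls. So the supremum is at most [M] plus half of itself. *)
Lemma bilin_le_net G M :
  (forall z w, z \in net d -> w \in net t ->
     bilin G (net_point R z) (net_point R w) <= M) ->
  forall x y, sqnorm x <= 1 -> sqnorm y <= 1 -> bilin G x y <= 2 * M.
Proof.
move=> netM.
pose B := [set r : R | exists x y,
  [/\ sqnorm x <= 1, sqnorm y <= 1 & r = bilin G x y]]%classic.
have B0 : (B !=set0)%classic.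
  exists (bilin G 0 0), 0, 0; split => //.
    by rewrite -sqr_enorm enorm0 expr0n.
  by rewrite -sqr_enorm enorm0 expr0n.
have ubB : has_ubound B.
  exists (\sum_j \sum_i `|G i j|) => _ [x [y [x1 y1 ->]]].
  exact: bilin_entries.
have leK x y : sqnorm x <= 1 -> sqnorm y <= 1 -> bilin G x y <= sup B.
  by move=> x1 y1; apply: ub_le_sup => //; exists x, y.
(* Four times a rounding residual is again in the unit ball, which yields the quarter. *)
have scale16 m (v : 'rV[R]_m) : sqnorm v <= 1 / 16 -> sqnorm (4 *: v) <= 1.
  by move=> v1; rewrite sqnormZ; lra.
have supB : sup B <= M + sup B / 2.
  apply: ge_sup => // _ [x [y [x1 y1 ->]]].
  have [z zN zx] := net_approx d_gt0 x1; have [w wN wy] := net_approx t_gt0 y1.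
  have h1 := leK _ _ (scale16 _ _ zx) (net_point_in_ball R t_gt0 wN).
  have h2 := leK _ _ x1 (scale16 _ _ wy).
  have h3 := netM z w zN wN.
  rewrite bilinZl in h1; rewrite bilinZr in h2.
  have -> : bilin G x y = bilin G (net_point R z) (net_point R w)
      + bilin G (x - net_point R z) (net_point R w)
      + bilin G x (y - net_point R w).
    by rewrite -bilinDl [_ z + _]addrC subrK -bilinDr [_ w + _]addrC subrK.
  lra.
move=> x y x1 y1; have := leK x y x1 y1; lra.
Qed.

(** Test the form on the normalized [v] and the normalized [v *m G]; zero vectors are treated
    apart. *)
Lemma operator_norm_le_bilin G K : 0 <= K ->
  (forall x y, sqnorm x <= 1 -> sqnorm y <= 1 -> bilin G x y <= K) ->
  forall v, enorm (v *m G) <= K * enorm v.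
Proof.
move=> K0 bK v.
have [v0|v0] := eqVneq (enorm v) 0.
  by rewrite (enorm_eq0 v0) mul0mx !enorm0 mulr0.
have [->|w0] := eqVneq (enorm (v *m G)) 0; first by rewrite mulr_ge0 // enorm_ge0.
have normalized m (u : 'rV[R]_m) : enorm u != 0 -> sqnorm ((enorm u)^-1 *: u) <= 1.
  by move=> u0; rewrite sqnormZ -sqr_enorm -exprMn mulVf // expr1n.
have := bK _ _ (normalized _ _ v0) (normalized _ _ w0).
rewrite bilinZl bilinZr /bilin sqnorm_mulmx -sqr_enorm expr2 mulKf //.
by rewrite ler_pdivrMl ?[K * _]mulrC // lt0r v0 enorm_ge0.
Qed.

End OperatorNorm.

(** * Random signs: moments, exponential moments and tail bounds, all as counts of sign patterns *)

Section RandomSigns.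
Variable R : realType.

(** The subgaussian bound for one sign, with a constant generous enough for an elementary proof: up
    to 1/2 it follows from [1 + y <= expR y], and beyond 1/2 from [x <= 2 * x ^+ 2]. *)
Lemma cosh_le (x : R) : expR x + expR (- x) <= 2 * expR (2 * x ^+ 2).
Proof.
wlog x0 : x / 0 <= x.
  move=> h; have [/h//|x0] := leP 0 x.
  by have := h (- x); rewrite opprK sqrrN addrC; apply; lra.
have [xh|xh] := leP x (1 / 2).
  have e1 : expR x <= 1 + x + 2 * x ^+ 2.
    have h : 1 <= (1 + x + 2 * x ^+ 2) * (1 - x).
      have -> : (1 + x + 2 * x ^+ 2) * (1 - x) = 1 + x ^+ 2 * (1 - 2 * x) by ring.
      by rewrite lerDl mulr_ge0 ?sqr_ge0 //; lra.
    have h2 : (1 - x) * expR x <= 1.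
      rewrite -[leRHS](@expRxMexpNx_1 _ x) [leRHS]mulrC ler_wpM2r ?expR_ge0 //.
      exact: expR_ge1Dx.
    have h3 := expR_gt0 x; have : 0 < 1 - x by lra.
    move=> h4; rewrite -(ler_pM2l h4); lra.
  have e2 : expR (- x) <= 1 - x + 2 * x ^+ 2.
    have h : (1 + x) * expR (- x) <= 1.
      rewrite -[leRHS](@expRxMexpNx_1 _ x) ler_wpM2r ?expR_ge0 //.
      exact: expR_ge1Dx.
    have h4 : 0 < 1 + x by lra.
    rewrite -(ler_pM2l h4); apply: le_trans h _.
    have -> : (1 + x) * (1 - x + 2 * x ^+ 2) = 1 + x ^+ 2 * (1 + 2 * x) by ring.
    by rewrite lerDl mulr_ge0 ?sqr_ge0 //; lra.
  have := expR_ge1Dx (2 * x ^+ 2); lra.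
have e1 : expR x <= expR (2 * x ^+ 2) by rewrite ler_expR; nra.
have e2 : expR (- x) <= expR (2 * x ^+ 2) by rewrite ler_expR; nra.
lra.
Qed.

(** Reduces a Laplace transform of a square to second and fourth moments. *)
Lemma expRN_le (x : R) : 0 <= x -> expR (- x) <= 1 - x + x ^+ 2.
Proof.
move=> x0.
have h : (1 + x) * expR (- x) <= 1.
  by rewrite -[leRHS](@expRxMexpNx_1 _ x) ler_wpM2r ?expR_ge0 // expR_ge1Dx.
have h4 : 0 < 1 + x by lra.
rewrite -(ler_pM2l h4); apply: le_trans h _.
have -> : (1 + x) * (1 - x + x ^+ 2) = 1 + x ^+ 3 by ring.
by rewrite lerDl exprn_ge0.
Qed.

(** Markov's inequality for the counting measure. *)
Lemma markov_card (T : finType) (B : {set T}) (f : T -> R) c :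
  (forall w, 0 <= f w) -> (forall w, w \in B -> c <= f w) ->
  c * #|B|%:R <= \sum_w f w.
Proof.
move=> f0 fB; rewrite mulr_natr -sumr_const big_mkcond; apply: ler_sum => w _.
by case: ifP => // /fB.
Qed.

Variable d : nat.
Implicit Types (v : 'rV[R]_d) (e : {ffun 'I_d -> bool}).

Definition flip (i : 'I_d) e : {ffun 'I_d -> bool} :=
  [ffun l => e l (+) (l == i)].

Lemma flipK i : involutive (flip i).
Proof. by move=> e; apply/ffunP => l; rewrite !ffunE addbK. Qed.

(** Flipping sign [i] permutes the patterns and negates the sum. This is how independence of the
    signs enters the moments. *)
Lemma sum_flip_odd i (g : {ffun 'I_d -> bool} -> R) :
  (forall e, g (flip i e) = g e) -> \sum_e g e * (-1) ^+ e i = 0.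
Proof.
move=> gi; set s := \sum_e _.
have : s = - s.
  rewrite {1}/s (reindex_inj (inv_inj (flipK i))) -sumrN /=.
  apply: eq_bigr => e _; rewrite gi ffunE eqxx addbT signrN.
  by rewrite mulrN.
lra.
Qed.

Definition rademacher v e : R := \sum_i v ord0 i * (-1) ^+ e i.

(** Restricted to a list of coordinates so that moments can be computed by induction on the list. *)
Definition signed_sum v (r : seq 'I_d) e : R := \sum_(i <- r) v ord0 i * (-1) ^+ e i.

Lemma signed_sum_flip v r i e : i \notin r ->
  signed_sum v r (flip i e) = signed_sum v r e.
Proof.
move=> ir; rewrite /signed_sum !big_seq; apply: eq_bigr => l lr.
rewrite ffunE; case: eqVneq lr => [->|_ _]; first by rewrite (negbTE ir).
by rewrite addbF.
Qed.

Local Notation N := (#|{: {ffun 'I_d -> bool}}|%:R : R).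

(** When a coordinate [q] is added, odd powers of its sign cancel. The fourth moment gains
    [6 * q ^+ 2 * Q + q ^+ 4] per pattern on average, up to the induction bound, and this fits into
    [3 * (q ^+ 2 + Q) ^+ 2]. *)
Lemma signed_sum_moments v r : uniq r ->
  \sum_e signed_sum v r e ^+ 2 = N * \sum_(i <- r) v ord0 i ^+ 2 /\
  \sum_e signed_sum v r e ^+ 4 <= 3 * N * (\sum_(i <- r) v ord0 i ^+ 2) ^+ 2.
Proof.
elim: r => [_|i r IH /= /andP [ir /IH [m2 m4]]].
  rewrite !big_nil !mulr0 !expr0n mulr0.
  by split; rewrite ?big1 // => e _; rewrite /signed_sum big_nil expr0n.
set q := v ord0 i; set Q := \sum_(l <- r) _ in m2 m4.
have odd1 n : \sum_e signed_sum v r e ^+ n * (-1) ^+ e i = 0.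
  by apply: sum_flip_odd => e; rewrite signed_sum_flip.
have cst (a : R) : \sum_(e : {ffun 'I_d -> bool}) a = N * a.
  by rewrite sumr_const mulr_natl.
have N0 : 0 <= N by rewrite ler0n.
rewrite big_cons -/Q -/q; split.
  transitivity (\sum_e (signed_sum v r e ^+ 2 + q ^+ 2 +
      2 * q * (signed_sum v r e ^+ 1 * (-1) ^+ e i))).
    apply: eq_bigr => e _; rewrite {1}/signed_sum big_cons -/(signed_sum v r e) -/q.
    by case: (e i); rewrite ?expr1 ?expr0; ring.
  by rewrite !big_split /= cst -mulr_sumr odd1 m2; ring.
have -> : \sum_e signed_sum v (i :: r) e ^+ 4 = \sum_e (signed_sum v r e ^+ 4 +
    (6 * q ^+ 2) * signed_sum v r e ^+ 2 + q ^+ 4 +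
    ((4 * q) * (signed_sum v r e ^+ 3 * (-1) ^+ e i) +
     (4 * q ^+ 3) * (signed_sum v r e ^+ 1 * (-1) ^+ e i))).
  apply: eq_bigr => e _; rewrite {1}/signed_sum big_cons -/(signed_sum v r e) -/q.
  by case: (e i); rewrite ?expr1 ?expr0; ring.
rewrite !big_split /= cst -!mulr_sumr !odd1 m2 !mulr0 !addr0.
have : 0 <= N * q ^+ 4 by rewrite mulr_ge0 // exprn_even_ge0.
have -> : 3 * N * (q ^+ 2 + Q) ^+ 2 =
  3 * N * Q ^+ 2 + 6 * q ^+ 2 * (N * Q) + 3 * (N * q ^+ 4) by ring.
lra.
Qed.

Lemma rademacher_moment2 v : \sum_e rademacher v e ^+ 2 = N * sqnorm v.
Proof. exact: (signed_sum_moments v (index_enum_uniq _)).1. Qed.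

Lemma rademacher_moment4 v : \sum_e rademacher v e ^+ 4 <= 3 * N * sqnorm v ^+ 2.
Proof. exact: (signed_sum_moments v (index_enum_uniq _)).2. Qed.

(** With [l * Q = 1 / 6], the quadratic expansion has mean at most [1 - 1/6 + 3/36 = 1 - 1/12]. *)
Lemma rademacher_laplace v : 0 < sqnorm v ->
  \sum_e expR (- (rademacher v e ^+ 2 / (6 * sqnorm v))) <= N * expR (- (1 / 12)).
Proof.
move=> Q0; set Q := sqnorm v; set l := (6 * Q)^-1.
have l0 : 0 <= l by rewrite invr_ge0 mulr_ge0 // ltW.
have lQ : l * Q = 1 / 6 by rewrite /l; field; rewrite gt_eqF.
apply: (@le_trans _ _ (\sum_e (1 - l * rademacher v e ^+ 2
    + l ^+ 2 * rademacher v e ^+ 4))).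
  apply: ler_sum => e _.
  apply: le_trans (expRN_le _) _; first by rewrite mulr_ge0 ?sqr_ge0.
  by rewrite -/l le_eqVlt; apply/orP; left; apply/eqP; ring.
rewrite !big_split /= sumrN -!mulr_sumr sumr_const rademacher_moment2 -/Q.
have N0 : 0 <= N by rewrite ler0n.
have h : l ^+ 2 * (\sum_e rademacher v e ^+ 4) <= N * (1 / 12).
  apply: le_trans (ler_wpM2l (sqr_ge0 _) (rademacher_moment4 v)) _.
  have -> : l ^+ 2 * (3 * N * sqnorm v ^+ 2) = N * (3 * (l * Q) ^+ 2).
    by rewrite /Q; ring.
  by rewrite lQ ler_wpM2l //; lra.
have -> : l * (N * Q) = N * (l * Q) by ring.
have h2 := ler_wpM2l N0 (expR_ge1Dx (- (1 / 12) : R)).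
rewrite lQ; lra.
Qed.

Variable t : nat.

(** Indexed by columns first, so that sums over patterns of products over columns factor. *)
Definition sign_pattern := {ffun 'I_t -> {ffun 'I_d -> bool}}.
Implicit Type w : sign_pattern.

Definition sign_mx w : 'M[R]_(d, t) := \matrix_(i, j) (-1) ^+ w j i.

Local Notation N' := (#|{: sign_pattern}|%:R : R).

Lemma card_sign_pattern : N' = N ^+ t.
Proof. by rewrite card_ffun card_ord natrX. Qed.

Lemma sqnorm_sign_mx v w :
  sqnorm (v *m sign_mx w) = \sum_j rademacher v (w j) ^+ 2.
Proof.
by apply: eq_bigr => j _; rewrite mxE; under eq_bigr do rewrite mxE.
Qed.

(** Chernoff bound for the lower tail: the columns are independent, so the Laplace transform is at
    most [expR (- (t / 12))] on average, while on the event it is at least [expR (- (t / 24))]. *)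
Lemma card_contracted v :
  #|[set w | sqnorm (v *m sign_mx w) < t%:R / 4 * sqnorm v]|%:R <=
    N' * expR (- (t%:R / 24)).
Proof.
have [/sqnorm_eq0 ->|Q1] := eqVneq (sqnorm v) 0.
  (* The strict inequality empties the event for [v = 0]; differences of a point with itself thus
     cause no failure. *)
  rewrite (_ : [set w | _] = finset.set0) ?cards0 ?mulr_ge0 ?ler0n ?expR_ge0 //.
  apply/setP => w; rewrite !inE mul0mx.
  by rewrite -!sqr_enorm !enorm0 expr0n mulr0 ltxx.
have Q0 : 0 < sqnorm v by rewrite lt0r Q1 sqnorm_ge0.
set B := [set w | _].
have h := @markov_card _ B
  (fun w => expR (- (sqnorm (v *m sign_mx w) / (6 * sqnorm v)))) (expR (- (t%:R / 24))).
have {h} : expR (- (t%:R / 24)) * #|B|%:R <= N' * expR (- (t%:R / 12)).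
  apply: le_trans (h _ _) _ => [w|w|]; first exact: expR_ge0.
    rewrite inE => wB; rewrite ler_expR lerN2 ler_pdivrMr ?mulr_gt0 //; lra.
  have -> : \sum_w expR (- (sqnorm (v *m sign_mx w) / (6 * sqnorm v))) =
      (\sum_e expR (- (rademacher v e ^+ 2 / (6 * sqnorm v)))) ^+ t.
    rewrite -[in RHS](card_ord t) -prodr_const bigA_distr_bigA /=.
    apply: eq_bigr => w _; by rewrite sqnorm_sign_mx mulr_suml -sumrN expR_sum.
  rewrite card_sign_pattern.
  have -> : expR (- (t%:R / 12)) = expR (- (1 / 12)) ^+ t :> R.
    by rewrite -expRM_natl; congr expR; ring.
  rewrite -exprMn lerXn2r ?nnegrE ?rademacher_laplace //.
  by apply: sumr_ge0 => e _; apply: expR_ge0.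
rewrite -ler_pdivlMl ?expR_gt0 //; move=> h; apply: le_trans h _.
rewrite -expRN opprK mulrCA -expRD ler_wpM2l ?ler0n // ler_expR; lra.
Qed.

(** The exponential factors over the independent entries, and [cosh_le] bounds each factor. *)
Lemma sum_exp_bilin x y :
  \sum_w expR (bilin (sign_mx w) x y) <=
    N' * expR (2 * sqnorm x * sqnorm y).
Proof.
have -> : \sum_w expR (bilin (sign_mx w) x y) =
    \prod_j \prod_i (\sum_(b : bool) expR (x ord0 i * (-1) ^+ b * y ord0 j)).
  under [RHS]eq_bigr do rewrite bigA_distr_bigA /=.
  rewrite bigA_distr_bigA /=; apply: eq_bigr => w _.
  rewrite bilinE expR_sum; apply: eq_bigr => j _.
  by rewrite expR_sum; apply: eq_bigr => i _; rewrite mxE.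
have -> : N' * expR (2 * sqnorm x * sqnorm y) =
    \prod_j \prod_i (2 * expR (2 * (x ord0 i * y ord0 j) ^+ 2)).
  under [RHS]eq_bigr do rewrite big_split /= prodr_const card_ord -expR_sum.
  rewrite big_split /= prodr_const card_ord -expR_sum; congr (_ * expR _).
    by rewrite card_sign_pattern card_ffun card_bool card_ord natrX.
  rewrite /sqnorm mulr_sumr; apply: eq_bigr => j _.
  by rewrite mulr_sumr mulr_suml; apply: eq_bigr => i _; ring.
apply: ler_prod => j _; apply/andP; split.
  by apply: prodr_ge0 => i _; apply: sumr_ge0 => b _; apply: expR_ge0.
apply: ler_prod => i _; apply/andP; split.
  by apply: sumr_ge0 => b _; apply: expR_ge0.
rewrite big_bool /= expr1 expr0 addrC.
have := cosh_le (x ord0 i * y ord0 j).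
by rewrite mulrN1 mulr1 mulNr.
Qed.

Lemma card_bilin_gt x y M : 0 <= M -> sqnorm x <= 1 -> sqnorm y <= 1 ->
  #|[set w | M < bilin (sign_mx w) x y]|%:R <= N' * expR (- (M ^+ 2 / 8)).
Proof.
move=> M0 x1 y1; set B := [set w | _].
(* This choice minimizes the Chernoff exponent [2 * l ^+ 2 - l * M], with value [- M ^+ 2 / 8]. *)
pose l := M / 4; have l0 : 0 <= l by rewrite divr_ge0.
have : expR (l * M) * #|B|%:R <= N' * expR (2 * l ^+ 2).
  apply: le_trans (markov_card (f := fun w => expR (bilin (sign_mx w) (l *: x) y)) _ _) _.
  - by move=> w; apply: expR_ge0.
  - move=> w; rewrite inE => wB; rewrite ler_expR bilinZl ler_wpM2l // ltW //.
  apply: le_trans (sum_exp_bilin _ _) _.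
  rewrite ler_wpM2l ?ler0n // ler_expR sqnormZ.
  rewrite -[leRHS]mulr1 -!mulrA !ler_wpM2l ?sqr_ge0 //.
  by rewrite -[leRHS]mulr1 ler_pM ?sqnorm_ge0.
rewrite -ler_pdivlMl ?expR_gt0 //; move=> h; apply: le_trans h _.
by rewrite -expRN mulrCA -expRD ler_wpM2l ?ler0n // ler_expR /l; lra.
Qed.

End RandomSigns.

(** * Uniform probability on a finite set *)

Section UniformProbability.
Variables (R : realType) (N : nat).
Hypothesis N_gt0 : (0 < N)%N.

Let weight : {nonneg R} := (N%:R^-1)%:nng.

(** The uniform law on the first [N] naturals, carried by [nat] because every subset of it is
    measurable. *)
Definition uniform_nat : set nat -> \bar R :=
  mscale weight (msum (fun n => \d_n : {measure set nat -> \bar R}) N).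

HB.instance Definition _ := Measure.on uniform_nat.

Lemma uniform_natE (A : set nat) :
  uniform_nat A = (N%:R^-1 * \sum_(n < N) \1_A (n : nat))%:E.
Proof.
rewrite /uniform_nat /mscale /msum /= EFinM; congr (_ * _)%E.
by rewrite -sumEFin.
Qed.

Lemma uniform_natT : uniform_nat [set: nat] = 1%E.
Proof.
rewrite uniform_natE; under eq_bigr do rewrite indicT.
by rewrite sumr_const card_ord mulVf // pnatr_eq0 -lt0n.
Qed.

HB.instance Definition _ := Measure_isProbability.Build _ _ _ uniform_nat uniform_natT.

Definition uniform_nat_prob : probability nat R := uniform_nat.

End UniformProbability.

(** Turns counts into probabilities: [f] enumerates [T], so a bad set filling at most a third of [T]
    is avoided with probability at least 2/3. *)
Lemma uniform_finite_space (R : realType) (T : finType) (w0 : T) :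
  exists (Pr : probability nat R) (f : nat -> T), forall B : {set T},
    3 * #|B|%:R <= #|T|%:R :> R ->
    ((2 / 3)%:E <= Pr [set i | f i \notin B]%classic)%E.
Proof.
have T0 : (0 < #|T|)%N by apply/card_gt0P; exists w0.
exists (uniform_nat_prob R T0), (nth w0 (enum T)) => B hB.
rewrite /= uniform_natE lee_fin.
have -> : \sum_(n < #|T|) \1_[set i | nth w0 (enum T) i \notin B]%classic (n : nat)
    = #|~: B|%:R :> R.
  rewrite -sum1_card natr_sum (reindex_onto (@enum_val T predT) enum_rank) /=; last first.
    by move=> w _; apply: enum_rankK.
  rewrite big_mkcond [RHS]big_mkcond /=; apply: eq_bigr => n _.
  rewrite enum_valK eqxx andbT indicE inE (enum_val_nth w0).
  rewrite (_ : (_ \in _) = (nth w0 (enum T) n \notin B)); last first.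
    by apply/idP/idP; rewrite inE.
  by case: ifP.
have T1 : 0 < #|T|%:R :> R by rewrite ltr0n.
rewrite ler_pdivlMl //.
have : #|B|%:R + #|~: B|%:R = #|T|%:R :> R by rewrite -natrD cardsC.
lra.
Qed.

(** * Union bounds for the random sign matrix *)

Section RandomEmbedding.
Variables (R : realType) (d t : nat).
Hypotheses (d_gt0 : (0 < d)%N) (t_gt0 : (0 < t)%N).

Lemma card_bigcup_le (I T : finType) (A : {set I}) (F : I -> {set T}) (c : R) :
  (forall i, i \in A -> #|F i|%:R <= c) ->
  #|(\bigcup_(i in A) F i)%SET|%:R <= #|A|%:R * c.
Proof.
move=> Fc; rewrite mulr_natl -[leRHS]sumr_const.
apply: (big_rec2 (fun (B : {set T}) (x : R) => #|B|%:R <= x)) => [|i B y iA IH].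
  by rewrite cards0.
apply: (@le_trans _ _ (#|F i|%:R + #|B|%:R)).
  by rewrite -natrD ler_nat leq_card_setU.
by rewrite lerD ?Fc.
Qed.

Lemma expR1_ge2 : 2 <= expR 1 :> R.
Proof. by have := expR_ge1Dx (1 : R); lra. Qed.

(** Chosen so that the tail exponent [opnorm_bound ^+ 2 / 8] is [20 * (d + t)], which beats the
    factor [2 ^ (18 * (d + t))] for pairs of net points. *)
Definition opnorm_bound : R := Num.sqrt (160 * (d + t)%:R).

Definition expanding : {set sign_pattern d t} :=
  (\bigcup_(z in net d) \bigcup_(z' in net t)
     [set w | opnorm_bound <
        bilin (sign_mx R w) (net_point R z) (net_point R z')])%SET.

Lemma card_expanding :
  6 * #|expanding|%:R <= #|{: sign_pattern d t}|%:R :> R.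
Proof.
set s : R := (d + t)%:R.
have s2 : 2 <= s by rewrite ler_nat (leq_add d_gt0 t_gt0).
set c : R := #|{: sign_pattern d t}|%:R * expR (- (opnorm_bound ^+ 2 / 8)).
have cE : c = #|{: sign_pattern d t}|%:R * expR (- (20 * s)).
  rewrite /c sqr_sqrtr ?mulr_ge0 //; congr (_ * expR _); rewrite -/s; lra.
have c0 : 0 <= c by rewrite mulr_ge0 ?expR_ge0.
have h : #|expanding|%:R <= #|net d|%:R * (#|net t|%:R * c).
  apply: card_bigcup_le => z zN; apply: card_bigcup_le => z' zN'.
  by apply: card_bilin_gt; rewrite ?sqrtr_ge0 ?net_point_in_ball.
have h2 : #|net d|%:R * #|net t|%:R <= expR (18 * s).
  have -> : expR (18 * s) = expR 1 ^+ (18 * d) * expR 1 ^+ (18 * t).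
    by rewrite -exprD -mulnDr -expRM_natl mulr1 natrM.
  have e n : #|net n|%:R <= expR 1 ^+ (18 * n) :> R.
    by apply: le_trans (card_net R n) _; rewrite lerXn2r ?nnegrE ?expR_ge0 ?expR1_ge2.
  by rewrite ler_pM ?ler0n.
have {h} : #|expanding|%:R <= expR (18 * s) * c.
  by apply: le_trans h _; rewrite mulrA ler_wpM2r.
rewrite cE mulrCA -expRD => h.
(* Here [s >= 2] gives [expR s >= 3], hence [expR (2 * s) >= 9]. *)
have h3 : expR (18 * s + - (20 * s)) <= 1 / 6.
  rewrite (_ : _ + _ = - (2 * s)); last lra.
  rewrite expRN ler_pdivlMr // ler_pdivrMl ?expR_gt0 // mulr1.
  have := expR_ge1Dx s; have -> : expR (2 * s) = expR s * expR s.
    by rewrite -expRD; congr expR; ring.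
  nra.
have := ler_wpM2l (ler0n R #|{: sign_pattern d t}|) h3; lra.
Qed.

Lemma sign_mx_upper w v : w \notin expanding ->
  enorm (v *m sign_mx R w) <= 2 * opnorm_bound * enorm v.
Proof.
move=> wE; apply: operator_norm_le_bilin.
  by rewrite mulr_ge0 ?sqrtr_ge0.
apply: bilin_le_net => // z z' zN zN'; rewrite leNgt; apply: contra wE => h.
by apply/bigcupP; exists z => //; apply/bigcupP; exists z' => //; rewrite inE.
Qed.

Variable k : nat.
Hypotheses (k_gt0 : (0 < k)%N) (t_ge : 120 * (1 + ln k%:R) <= t%:R :> R).

Definition contracting (p : 'I_k.+1 -> 'rV[R]_d) : {set sign_pattern d t} :=
  (\bigcup_(i in [set: 'I_k.+1]) \bigcup_(j in [set: 'I_k.+1])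
    [set w | sqnorm ((p i - p j) *m sign_mx R w) <
       t%:R / 4 * sqnorm (p i - p j)])%SET.

(** There are at most [4 * k ^ 2] ordered pairs, and [t / 24 >= 5 + 5 * ln k] makes each failure
    rate at most [expR (- 5) / k ^ 2]; finally [4 * expR (- 5) <= 1 / 6]. *)
Lemma card_contracting p :
  6 * #|contracting p|%:R <= #|{: sign_pattern d t}|%:R :> R.
Proof.
set N : R := #|{: sign_pattern d t}|%:R.
have h : #|contracting p|%:R <= k.+1%:R * (k.+1%:R * (N * expR (- (t%:R / 24)))).
  rewrite -[X in X%:R * (X%:R * _)]card_ord -cardsT.
  by do 2![apply: card_bigcup_le => ? _]; apply: card_contracted.
have k1 : 1 <= k%:R :> R by rewrite ler1n.
have lnk : 0 <= ln k%:R :> R by apply: ln_ge0.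
have kk : k.+1%:R * k.+1%:R <= 4 * (k%:R * k%:R) :> R.
  have -> : 4 * (k%:R * k%:R) = (2 * k%:R) * (2 * k%:R) :> R by ring.
  have ks : k.+1%:R = k%:R + 1 :> R by rewrite natr1.
  by rewrite ler_pM ?ler0n // ks; lra.
have e : expR (- (t%:R / 24)) <= expR (- 5) / (k%:R * k%:R) :> R.
  apply: (@le_trans _ _ (expR (- 5 - (ln k%:R + ln k%:R)))).
    by rewrite ler_expR; move: (t_ge) lnk; set a := ln _; set b := t%:R; lra.
  by rewrite expRD expRN expRD !lnK // posrE; lra.
have e5 : expR (- 5) <= 1 / 24 :> R.
  rewrite expRN ler_pdivlMr // ler_pdivrMl ?expR_gt0 // mulr1.
  have -> : 5 = 5%:R * 1 :> R by rewrite mulr1.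
  rewrite expRM_natl; apply: (@le_trans _ _ (2 ^+ 5)); first lra.
  by rewrite lerXn2r ?nnegrE ?expR_ge0 ?expR1_ge2.
have N0 : 0 <= N by rewrite ler0n.
have k2 : 0 < k%:R * k%:R :> R by nra.
have h2 : k.+1%:R * k.+1%:R * expR (- (t%:R / 24)) <= 1 / 6 :> R.
  apply: le_trans (ler_pM _ _ kk e) _; rewrite ?mulr_ge0 ?ler0n ?expR_ge0 //.
  set K := k%:R * k%:R in k2 *.
  have -> : 4 * K * (expR (- 5) / K) = 4 * expR (- 5) by field; rewrite gt_eqF.
  lra.
have := ler_wpM2l N0 h2.
rewrite (_ : N * _ = k.+1%:R * (k.+1%:R * (N * expR (- (t%:R / 24))))); last by ring.
lra.
Qed.

Lemma sign_mx_lower w p i j : w \notin contracting p ->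
  Num.sqrt t%:R / 2 * enorm (p i - p j) <= enorm ((p i - p j) *m sign_mx R w).
Proof.
move=> wC; rewrite -(@ler_pXn2r _ 2) ?nnegrE ?mulr_ge0 ?sqrtr_ge0 ?enorm_ge0 //.
rewrite !exprMn sqr_sqrtr // !sqr_enorm exprVn (_ : 2 ^+ 2 = 4); last by rewrite -natrX.
rewrite leNgt; apply: contra wC => h.
apply/bigcupP; exists i; rewrite ?inE //.
by apply/bigcupP; exists j; rewrite ?inE.
Qed.

End RandomEmbedding.

(** * Scaling, choice of the dimension, and assembly *)

Lemma opnorm_scaled_le (R : realType) (d t : nat) (alpha : R) : (0 < t)%N ->
  1 < alpha -> d%:R / alpha ^+ 2 <= t%:R ->
  4 / Num.sqrt t%:R * (2 * opnorm_bound R d t) <= 144 * alpha.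
Proof.
move=> t0 a1 dt.
have tp : 0 < t%:R :> R by rewrite ltr0n.
have ap : 0 < alpha by lra.
(* Squared, the left side is [10240 * (d + t) / t], at most [20480 * alpha ^+ 2], and
   [144 ^ 2 = 20736]. *)
rewrite -(@ler_pXn2r _ 2) ?nnegrE ?mulr_ge0 ?invr_ge0 ?sqrtr_ge0 //; last lra.
rewrite !exprMn exprVn !sqr_sqrtr ?mulr_ge0 ?ler0n // natrD.
have d_le : d%:R <= t%:R * alpha ^+ 2 by rewrite -ler_pdivrMr ?exprn_gt0.
rewrite mulrAC ler_pdivrMr //.
have a2 : 1 <= alpha ^+ 2 by rewrite expr_ge1 //; lra.
have := ler_wpM2l (ltW tp) a2; lra.
Qed.

Theorem theorem2p1 (R : realType) (beta : R) (hbeta : 1 <= beta) :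
  exists ct c1 c2 : R, [/\ 0 < ct, 0 < c1, 0 < c2 &
  forall (d : nat) (alpha : R) (k n : nat),
    (1 < d)%N -> 1 < alpha -> (1 <= k)%N -> (k <= n)%N ->
    exists t : nat,
      t%:R <= ct * (1 + ln k%:R + d%:R / alpha ^+ 2) /\
      exists (dsp : measure_display) (Omega : measurableType dsp)
             (Pr : probability Omega R) (G : Omega -> 'M[R]_(d, t)),
      forall P : seq 'rV[R]_d, uniq P -> size P = n ->
      exists E : set Omega,
        [/\ measurable E, ((2 / 3)%:E <= Pr E)%E &
        forall w, E w ->
          estimation (c1 * alpha) (opt_vanilla k P)
                     (opt_vanilla k (image_of (G w) P)) /\
          forall C : seq 'rV[R]_d, uniq C -> size C = k -> {subset C <= P} ->
            approx_sol k beta (image_of (G w) P) (image_of (G w) C) ->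
            approx_sol k (c2 * alpha) P C]].
Proof.
(* The map has norm bound [U = 144 * alpha]: 288 comes from [2 * U], and the last constant from
   [4 + (beta + 2) * U] with 4 absorbed by [alpha > 1]. In 121, the extra 1 pays for rounding [t]
   up. *)
exists 121, 288, (4 + (beta + 2) * 144); split => [||| d alpha k n d1 a1 k0 kn];
  [lra | lra | lra |].
set r := 120 * (1 + ln k%:R) + d%:R / alpha ^+ 2.
have lnk : 0 <= ln k%:R :> R by rewrite ln_ge0 // ler1n.
have da : 0 <= d%:R / alpha ^+ 2 by rewrite divr_ge0 // sqr_ge0.
have r0 : 0 <= r by rewrite /r; lra.
have d0 : (0 < d)%N by apply: ltnW.
pose t := (Num.truncn r).+1.
have t0 : (0 < t)%N by [].
have rt : r <= t%:R by rewrite ltW // truncnS_gt.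
have tr : t%:R <= r + 1 by rewrite -natr1 lerD2r truncn_le.
exists t; split; first by move: tr; rewrite /r; lra.
have t_lnk : 120 * (1 + ln k%:R) <= t%:R :> R by move: rt; rewrite /r; lra.
have t_da : d%:R / alpha ^+ 2 <= t%:R by move: rt; rewrite /r; lra.
have [Pr [f PrP]] := @uniform_finite_space R (sign_pattern d t)
  [ffun=> [ffun=> false]].
(* Turns the expansion factor [Num.sqrt t / 2] on the core into the 2 that the deterministic part
   asks for. *)
pose c : R := 4 / Num.sqrt t%:R.
have st : 0 < Num.sqrt t%:R :> R by rewrite sqrtr_gt0 ltr0n.
have c0 : 0 < c by rewrite divr_gt0.
exists _, _, Pr, (fun i => c *: sign_mx R (f i)) => P uP sP.
have kP : (k <= size P)%N by rewrite sP.
(* The random map is fixed before [P]; only the good event depends on [P], through its core. *)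
have [S [x [uS sS coreP sepS]]] := separated_core k0 kP uP.
pose p (i : 'I_k.+1) := nth 0 (x :: S) i.
pose bad := (expanding R d t :|: contracting t p)%SET.
exists [set i | f i \notin bad]%classic; split => //.
  apply: PrP.
  (* Each of the two bad sets fills at most a sixth of the patterns, hence together at most a
     third. *)
  have := card_expanding R d0 t0; have := card_contracting k0 t_lnk p.
  have : #|bad|%:R <= #|expanding R d t|%:R + #|contracting t p|%:R :> R.
    by rewrite -natrD ler_nat leq_card_setU.
  lra.
move=> i /=; rewrite finset.in_setU negb_or => /andP [notE notC].
set G := c *: _.
have mulG v : v *m G = c *: (v *m sign_mx R (f i)) by rewrite -scalemxAr.
have upper v : enorm (v *m G) <= 144 * alpha * enorm v.
  rewrite mulG enormZ gtr0_norm //.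
  apply: le_trans (ler_wpM2l (ltW c0) (sign_mx_upper d0 t0 v notE)) _.
  by rewrite mulrA ler_wpM2r ?enorm_ge0 // opnorm_scaled_le.
have lower u v : u \in x :: S -> v \in x :: S ->
    2 * enorm (u - v) <= enorm ((u - v) *m G).
  move=> uT vT.
  have pE y : y \in x :: S -> exists l, p l = y.
    move=> yT; have yk : (index y (x :: S) < k.+1)%N by rewrite -sS -index_mem in yT *.
    by exists (Ordinal yk); rewrite /p /= nth_index.
  have [l <-] := pE u uT; have [l' <-] := pE v vT.
  have h := sign_mx_lower l l' notC.
  rewrite mulG enormZ gtr0_norm //; apply: le_trans (ler_wpM2l (ltW c0) h).
  by rewrite mulrA (_ : c * _ = 2) // /c; field; rewrite gt_eqF.
have U0 : 0 <= 144 * alpha by lra.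
split.
  have := embedding_estimation k0 uS sS coreP sepS U0 upper lower.
  by rewrite mulrA -natrM.
move=> C uC sC CP hC.
have b0 : 0 <= beta by lra.
have [_ _ _ costC] := embedding_approx k0 uS sS coreP sepS U0 upper lower b0 uC sC CP hC.
split => //; apply: le_trans costC _; rewrite ler_wpM2r //.
  by apply: le_opt_vanilla => [|D _ _]; [exists C | apply: kcost_ge0].
nra.
Qed.
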